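(* Let $\mathcal{T}$ be a cellular complex, $L$ a flat discrete vector bundle on $\mathcal{T}$, and $A$ a finite element system on $\mathcal{T}$ (with respect to $L$). Suppose that $A$ is compatible. Then the evaluation maps $\mathsf{e}:A^\bullet(\mathcal{T})\to\mathcal{C}^\bullet(\mathcal{T},L)$ induce isomorphisms on cohomology groups.
   Context: **Cellular complexes.** A cellular complex $\mathcal{T}$ is a finite collection of closed cells (each homeomorphic to a closed ball) with disjoint interiors, such that the boundary of each cell is a union of lower-dimensional cells of $\mathcal{T}$ (a finite regular CW complex). $T'\trianglelefteq T$ means that $T'$ is a subcell of $T$; $\mathcal{T}^k$ is the set of $k$-dimensional cells; $\mathcal{S}(T)$ is the complex of all subcells of $T$ (including $T$) and $\partial T$ the complex of strict subcells of $T$ (empty if $T$ is a point). Each cell of dimension at least one is oriented; $\mathrm{o}(T,T')=\pm1$ is the relative orientation (incidence number) if $T'$ is a codimension 1 face of $T$, and $0$ otherwise. **Flat discrete vector bundle $L$.** A vector space $L(T)$ for each $T\in\mathcal{T}$ and isomorphisms $\mathsf{t}_{TT'}:L(T')\to L(T)$ whenever $T'$ is a codimension 1 face of $T$, such that whenever $T''$ is a codimension 2 face of $T$ and $T'_0,T'_1$ are the two codimension 1 faces of $T$ containing $T''$, $\mathsf{t}_{TT'_0}\mathsf{t}_{T'_0T''}=\mathsf{t}_{TT'_1}\mathsf{t}_{T'_1T''}$. For a subcomplex $\mathcal{T}'$, $\mathcal{C}^k(\mathcal{T}',L)=\prod_{T\in\mathcal{T}'^k}L(T)$, with differential $(\delta_{\mathsf{t}}u)(T)=\sum_{T'\trianglelefteq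 T}\mathrm{o}(T,T')\mathsf{t}_{TT'}u(T')$; this is a complex. **Finite element system (FES) $A$.** It consists of: - vector spaces $A^k(T)$ for $T\in\mathcal{T}$, $k\in\mathbb{Z}$, with $A^k(T)=0$ for $k<0$; - linear differentials $\mathsf{d}^k_T:A^k(T)\to A^{k+1}(T)$ with $\mathsf{d}^{k+1}_T\mathsf{d}^k_T=0$; - linear restriction maps $\mathsf{r}_{T'T}:A^k(T)\to A^k(T')$ for $T'\trianglelefteq T$, with $\mathsf{r}_{T'T}\mathsf{d}_T=\mathsf{d}_{T'}\mathsf{r}_{T'T}$ and $\mathsf{r}_{T''T}=\mathsf{r}_{T''T'}\mathsf{r}_{T'T}$ for $T''\trianglelefteq T'\trianglelefteq T$; - for each $k$-dimensional cell $T$ a linear evaluation map $\mathsf{e}_T:A^k(T)\to L(T)$ such that for $u\in A^{k-1}(T)$, $\mathsf{e}_T\mathsf{d}_Tu=\sum_{T'\in\partial T}\mathrm{o}(T,T')\,\mathsf{t}_{TT'}\,\mathsf{e}_{T'}\,\mathsf{r}_{T'T}u$. **Glued spaces and de Rham map.** For a cellular subcomplex $\mathcal{T}'$ of $\mathcal{T}$, $A^k(\mathcal{T}')=\{(u_T)_{T\in\mathcal{T}'}\in\bigoplus_{T\in\mathcal{T}'}A^k(T): T'\trianglelefteq T\Rightarrow u_{T'}=\mathsf{r}_{T'T}u_T\}$, a complex with cellwise differential; $A^k(\mathcal{S}(T))$ is identified with $A^k(T)$. The maps $u\mapsto(\mathsf{e}_Tu_T)_{T\in\mathcal{T}'^k}$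 form a morphism of complexes $\mathsf{e}:A^\bullet(\mathcal{T}')\to\mathcal{C}^\bullet(\mathcal{T}',L)$ (the evaluation or de Rham map). **Compatibility.** $A$ is *flabby* (admits extensions) if for each $T\in\mathcal{T}$ and each $k$ the restriction $A^k(T)\to A^k(\partial T)$ is surjective. $A$ is *locally exact* if for each $T\in\mathcal{T}$ the de Rham map $A^\bullet(T)\to\mathcal{C}^\bullet(\mathcal{S}(T),L)$ induces isomorphisms on cohomology (equivalently, $A^0(T)\to A^1(T)\to\cdots$ is exact at every index $\geq1$, and the map from $\ker(\mathsf{d}:A^0(T)\to A^1(T))$ to $L(T)$ given by restricting to a vertex of $T$, evaluating there, and transporting to $T$, is an isomorphism). $A$ is *compatible* if it is flabby and locally exact. *)

(* Defs.v *)
From HB Require Import structures.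
From mathcomp Require Import all_boot all_order all_algebra.
From mathcomp Require Import generic_quotient ring_quotient.
From mathcomp Require Import boolp classical_sets functions reals topology normedtype.

Set Implicit Arguments.
Unset Strict Implicit.
Unset Printing Implicit Defensive.

Import Order.TTheory GRing.Theory Num.Theory.
Import numFieldNormedType.Exports.

Local Open Scope classical_set_scope.
Local Open Scope ring_scope.

Section DependentProduct.
Variables (F : fieldType) (I : Type) (V : I -> lmodType F).

Definition dprod : Type := forall i, V i.

HB.instance Definition _ := Choice.copy dprod (forall i, V i).

Implicit Types f g h : dprod.

Let dadd f g : dprod := fun i => f i + g i.
Let dopp f : dprod := fun i => - f i.
Let dscale (a : F) f : dprod := fun i => a *: f i.
Let dzero : dprod := fun=> 0.

Let daddA : associative dadd.
Proof. by move=> f g h; apply: functional_extensionality_dep => i; exact: addrA. Qed.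
Let daddC : commutative dadd.
Proof. by move=> f g; apply: functional_extensionality_dep => i; exact: addrC. Qed.
Let dadd0 : left_id dzero dadd.
Proof. by move=> f; apply: functional_extensionality_dep => i; exact: add0r. Qed.
Let daddN : left_inverse dzero dopp dadd.
Proof. by move=> f; apply: functional_extensionality_dep => i; exact: addNr. Qed.

HB.instance Definition _ := GRing.isZmodule.Build dprod daddA daddC dadd0 daddN.

Let dscaleA a b f : dscale a (dscale b f) = dscale (a * b) f.
Proof. by apply: functional_extensionality_dep => i; exact: scalerA. Qed.
Let dscale1 : left_id 1 dscale.
Proof. by move=> f; apply: functional_extensionality_dep => i; exact: scale1r. Qed.
Let dscaleDr : right_distributive dscale +%R.
Proof. by move=> a f g; apply: functional_extensionality_dep => i; exact: scalerDr. Qed.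
Let dscaleDl f : {morph dscale^~ f : a b / a + b}.
Proof. by move=> a b; apply: functional_extensionality_dep => i; exact: scalerDl. Qed.

HB.instance Definition _ :=
  GRing.Zmodule_isLmodule.Build F dprod dscaleA dscale1 dscaleDr dscaleDl.

Lemma dprodP f g : (forall i, f i = g i) -> f = g.
Proof. exact: functional_extensionality_dep. Qed.

Lemma dprod0E i : (0 : dprod) i = 0. Proof. by []. Qed.
Lemma dprodDE f g i : (f + g) i = f i + g i. Proof. by []. Qed.
Lemma dprodZE a f i : (a *: f) i = a *: f i. Proof. by []. Qed.

End DependentProduct.

Section Submodule.
Variables (F : fieldType) (V : lmodType F) (W : submodClosed V).

Record submodule : Type := Submodule { submodule_val : V; _ : submodule_val \in W }.

HB.instance Definition _ := [isSub for submodule_val].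
HB.instance Definition _ := [Choice of submodule by <:].
HB.instance Definition _ := [SubChoice_isSubLmodule of submodule by <:].

End Submodule.

Section QuotientModule.
Variables (F : fieldType) (V : lmodType F) (W : submodClosed V).

(* The library's [Quotient.quot] is only a [zmodType]; it is equipped here with
   the induced scaling. *)
Definition quot_ideal : {pred V} := fun v => v \in W.

Let quot_ideal_closed : zmod_closed quot_ideal.
Proof.
have E v : (v \in quot_ideal) = (v \in W) by [].
split=> [|u v]; rewrite !E ?rpred0 // => uW vW.
by rewrite -scaleN1r rpredD // rpredZ.
Qed.

HB.instance Definition _ := GRing.isZmodClosed.Build V quot_ideal quot_ideal_closed.

Definition quotmod : Type := Quotient.quot quot_ideal.

HB.instance Definition _ := GRing.Zmodule.on quotmod.

Definition qproj (v : V) : quotmod := \pi_(Quotient.quot quot_ideal)%qT v.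

Lemma qprojP u v : reflect (qproj u = qproj v) (u - v \in W).
Proof.
have -> : (u - v \in W) = (u - v \in quot_ideal) by [].
by rewrite Quotient.idealrBE; exact: eqP.
Qed.

Lemma qprojK (q : quotmod) : qproj (generic_quotient.repr q) = q.
Proof. exact: reprK. Qed.

Lemma qprojD : {morph qproj : u v / u + v}.
Proof. exact: raddfD. Qed.

Let qscale (a : F) (q : quotmod) : quotmod := qproj (a *: generic_quotient.repr q).

Let qscaleE a v : qscale a (qproj v) = qproj (a *: v).
Proof.
by apply/qprojP; rewrite -scalerBr rpredZ //; apply/qprojP; rewrite qprojK.
Qed.

Let qscaleA a b q : qscale a (qscale b q) = qscale (a * b) q.
Proof. by rewrite -[q]qprojK !qscaleE scalerA. Qed.
Let qscale1 : left_id 1 qscale.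
Proof. by move=> q; rewrite -[q]qprojK qscaleE scale1r. Qed.
Let qscaleDr : right_distributive qscale +%R.
Proof.
by move=> a p q; rewrite -[p]qprojK -[q]qprojK -qprojD !qscaleE scalerDr qprojD.
Qed.
Let qscaleDl q : {morph qscale^~ q : a b / a + b}.
Proof. by move=> a b; rewrite -[q]qprojK !qscaleE scalerDl qprojD. Qed.

HB.instance Definition _ :=
  GRing.Zmodule_isLmodule.Build F quotmod qscaleA qscale1 qscaleDr qscaleDl.

Let qproj_linear : linear qproj.
Proof. by move=> a u v; rewrite qprojD -qscaleE. Qed.

HB.instance Definition _ := GRing.isLinear.Build F V quotmod *:%R qproj qproj_linear.

End QuotientModule.

Record cochain_complex (F : fieldType) := CochainComplex {
  cobj :> nat -> lmodType F;
  cdiff : forall k, {linear cobj k -> cobj k.+1};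
  cdiffK : forall k (x : cobj k), cdiff k.+1 (cdiff k x) = 0 }.

Arguments cdiff {F} _ {k}.

Record cochain_map (F : fieldType) (C D : cochain_complex F) := CochainMap {
  cmap :> forall k, {linear C k -> D k};
  cmap_diff : forall k (x : C k), cmap k.+1 (cdiff C x) = cdiff D (cmap k x) }.

Section CochainComp.
Variables (F : fieldType) (C D E : cochain_complex F).
Variables (g : cochain_map D E) (f : cochain_map C D).

Let comp k : {linear C k -> E k} := g k \o f k.
Let comp_diff k (x : C k) : comp k.+1 (cdiff C x) = cdiff E (comp k x).
Proof. by rewrite /= !cmap_diff. Qed.

Definition cochain_comp := CochainMap comp_diff.

End CochainComp.

Section Cohomology.
Variables (F : fieldType) (C : cochain_complex F).

Definition cocycle k : {pred C k} := fun x => cdiff C x == 0.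

Let cocycle_closed k : submod_closed (@cocycle k).
Proof.
split=> [|a u v]; rewrite !unfold_in ?linear0 // => /eqP du /eqP dv.
by rewrite linearP du dv scaler0 addr0.
Qed.

HB.instance Definition _ k :=
  GRing.isSubmodClosed.Build F (C k) (@cocycle k) (@cocycle_closed k).

Definition cocycles k := submodule (@cocycle k).

(* The object in degree [-1] is zero. *)
Definition is_coboundary k : C k -> Prop :=
  match k with
  | 0 => fun x => x = 0
  | j.+1 => fun x => exists y : C j, cdiff C y = x
  end.

Definition coboundary k : {pred cocycles k} :=
  fun z => `[< is_coboundary (val z) >].

Let coboundary_cx_closed k : submod_closed (@coboundary k).
Proof.
case: k => [|k]; split=> [|a u v]; rewrite !unfold_in.
- exact/asboolP.
- move=> /asboolP /= u0 /asboolP /= v0; apply/asboolP => /=.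
  by rewrite u0 v0 scaler0 addr0.
- by apply/asboolP => /=; exists 0; rewrite linear0.
- move=> /asboolP /= [x xu] /asboolP /= [y yv]; apply/asboolP => /=.
  by exists (a *: x + y); rewrite linearP xu yv.
Qed.

HB.instance Definition _ k :=
  GRing.isSubmodClosed.Build F (cocycles k) (@coboundary k) (@coboundary_cx_closed k).

Definition cohomology k := quotmod (@coboundary k).

End Cohomology.

Section InducedMap.
Variables (F : fieldType) (C D : cochain_complex F) (f : cochain_map C D).

Let cocycle_cmap k (z : cocycles C k) : f k (val z) \in cocycle (C := D) (k := k).
Proof.
by case: z => z /= /eqP dz; rewrite unfold_in -cmap_diff dz linear0.
Qed.

Definition cocycle_map k (z : cocycles C k) : cocycles D k :=
  Submodule (cocycle_cmap z).

Let cocycle_map_linear k : linear (@cocycle_map k).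
Proof. by move=> a u v; apply: val_inj; rewrite /= linearP. Qed.

HB.instance Definition _ k :=
  GRing.isLinear.Build F (cocycles C k) (cocycles D k) *:%R (@cocycle_map k)
    (@cocycle_map_linear k).

Definition cohomology_map k (h : cohomology C k) : cohomology D k :=
  qproj (coboundary (k := k)) (cocycle_map (generic_quotient.repr h)).

Lemma cohomology_mapE k (z : cocycles C k) :
  cohomology_map (qproj (coboundary (k := k)) z) =
  qproj (coboundary (k := k)) (cocycle_map z).
Proof.
apply/qprojP; rewrite -linearB /=.
have : generic_quotient.repr (qproj (coboundary (k := k)) z) - z
    \in coboundary (C := C) (k := k) by apply/qprojP; rewrite qprojK.
move: (_ - z) => w; rewrite !unfold_in => /asboolP wP; apply/asboolP.
case: k z w wP => [|k] z w /= => [->|[y yw]]; first by rewrite linear0.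
by exists (f k y); rewrite -yw cmap_diff.
Qed.

Let cohomology_map_linear k : linear (@cohomology_map k).
Proof.
move=> a p q; rewrite -[p]qprojK -[q]qprojK -linearP !cohomology_mapE.
by rewrite -linearP -linearP.
Qed.

HB.instance Definition _ k :=
  GRing.isLinear.Build F (cohomology C k) (cohomology D k) *:%R
    (@cohomology_map k) (@cohomology_map_linear k).

Definition quasi_isomorphism := forall k, bijective (@cohomology_map k).

End InducedMap.

Section Balls.
Variables (R : realType) (n : nat).

(* Euclidean balls: the norm of ['rV[R]_n] in the library is the sup norm. *)
Definition closed_disk : set 'rV[R]_n := [set x | \sum_i x ord0 i ^+ 2 <= 1].
Definition open_disk : set 'rV[R]_n := [set x | \sum_i x ord0 i ^+ 2 < 1].
Definition unit_sphere : set 'rV[R]_n := [set x | \sum_i x ord0 i ^+ 2 = 1].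

End Balls.

Arguments closed_disk : clear implicits.
Arguments open_disk : clear implicits.
Arguments unit_sphere : clear implicits.

Definition homeomorphism_on (X Y : topologicalType) (A : set X) (B : set Y)
    (f : X -> Y) : Prop :=
  [/\ {within A, continuous f}, f @` A = B &
      exists2 g : Y -> X, {within B, continuous g} & {in A, cancel f g}].

(* The cells are subsets of an ambient Hausdorff space, indexed injectively by
   a finite type.  The interior and the boundary of a cell are the images of the
   open ball and of the sphere; by invariance of domain they do not depend on
   the parametrization. *)
Record cellular_complex (R : realType) := CellularComplex {
  space : topologicalType;
  space_hausdorff : hausdorff_space space;
  cell : finType;
  dim : cell -> nat;
  carrier : cell -> set space;
  carrier_inj : injective carrier;
  chart : forall T : cell, 'rV[R]_(dim T) -> space;
  chart_homeo : forall T,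
    homeomorphism_on (closed_disk R (dim T)) (carrier T) (@chart T);
  interiors_disjoint : forall S T, S != T ->
    (@chart S @` open_disk R (dim S)) `&` (@chart T @` open_disk R (dim T)) = set0;
  boundary_union : forall T, exists B : {set cell},
    (forall S, S \in B -> (dim S < dim T)%N) /\
    @chart T @` unit_sphere R (dim T) = \bigcup_(S in [set` B]) carrier S }.

Section Cells.
Variables (R : realType) (X : cellular_complex R).
Implicit Types S T : cell X.

Definition subcell S T : bool := `[< carrier S `<=` carrier T >].

Definition face1 S T : bool := subcell S T && (dim T == (dim S).+1).

Lemma subcell_refl T : subcell T T.
Proof. exact/asboolP. Qed.

Lemma subcell_trans S T U : subcell S T -> subcell T U -> subcell S U.
Proof. by move=> /asboolP ST /asboolP TU; apply/asboolP; apply: subset_trans TU. Qed.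

Lemma subcell_anti S T : subcell S T -> subcell T S -> S = T.
Proof.
by move=> /asboolP ST /asboolP TS; apply: (@carrier_inj R X); apply/seteqP.
Qed.

Record subcomplex := Subcomplex {
  subcomplex_set :> {set cell X};
  subcomplex_closed : forall S T,
    subcell S T -> T \in subcomplex_set -> S \in subcomplex_set }.

Let whole_closed S T : subcell S T -> T \in [set: cell X]%SET -> S \in [set: cell X]%SET.
Proof. by rewrite !inE. Qed.

Definition whole := Subcomplex whole_closed.

Let closure_cx_closed U S T :
  subcell S T -> T \in [set V | subcell V U]%SET -> S \in [set V | subcell V U]%SET.
Proof. by rewrite !finset.in_set; exact: subcell_trans. Qed.

Definition closure_cx U := Subcomplex (@closure_cx_closed U).

Let boundary_cx_closed U S T :
  subcell S T -> T \in [set V | subcell V U && (V != U)]%SET ->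
  S \in [set V | subcell V U && (V != U)]%SET.
Proof.
rewrite !finset.in_set => ST /andP[TU neTU]; rewrite (subcell_trans ST TU) /=.
apply: contra_neq neTU => SU; apply: subcell_anti TU _.
by rewrite -SU.
Qed.

Definition boundary_cx U := Subcomplex (@boundary_cx_closed U).

End Cells.

(* Incidence numbers [rel_or T S] attached to a choice of orientation of every
   cell of positive dimension.  The last two identities (points being oriented
   positively) are the classical characterization of the functions that arise
   in this way on a regular CW complex. *)
Record orientation (R : realType) (X : cellular_complex R) := Orientation {
  rel_or :> cell X -> cell X -> int;
  rel_or_face : forall T S, face1 S T -> rel_or T S = 1 \/ rel_or T S = -1;
  rel_or_nface : forall T S, ~~ face1 S T -> rel_or T S = 0;
  rel_or_edge : forall T, dim T = 1%N -> \sum_S rel_or T S = 0;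
  rel_or_codim2 : forall T U, \sum_S rel_or T S * rel_or S U = 0 }.

(* [transport T S] is the map from the fibre at [S] to the fibre at [T]; it is
   meaningful only when [S] is a codimension 1 face of [T]. *)
Record flat_bundle (F : fieldType) (R : realType) (X : cellular_complex R) :=
  FlatBundle {
    fibre :> cell X -> lmodType F;
    transport : forall T S : cell X, {linear fibre S -> fibre T};
    transport_bij : forall T S, face1 S T -> bijective (transport T S);
    transport_flat : forall (T S0 S1 U : cell X),
      face1 S0 T -> face1 S1 T -> face1 U S0 -> face1 U S1 ->
      forall x : fibre U,
        transport T S0 (transport S0 U x) = transport T S1 (transport S1 U x) }.

Arguments transport {F R X} _ T S.

Section Cochains.
Variables (F : fieldType) (R : realType) (X : cellular_complex R).
Variables (o : orientation X) (L : flat_bundle F X).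
Implicit Type K : subcomplex X.

Definition kcell K (k : nat) := {T : cell X | (T \in subcomplex_set K) && (dim T == k)}.

Lemma kcell_dim K k (T : kcell K k) : dim (val T) = k.
Proof. by case: T => T /= /andP[_ /eqP]. Qed.

Lemma kcell_in K k (T : kcell K k) : val T \in subcomplex_set K.
Proof. by case: T => T /= /andP[]. Qed.

Definition cochain K k := dprod (fun T : kcell K k => L (val T)).

Definition delta K k (u : cochain K k) : cochain K k.+1 :=
  fun T => \sum_(S : kcell K k | subcell (val S) (val T))
             transport L (val T) (val S) (u S) *~ o (val T) (val S).

Let delta_linear K k : linear (@delta K k).
Proof.
move=> a u v; apply: dprodP => T; rewrite dprodDE dprodZE /delta scaler_sumr -big_split.
by apply: eq_bigr => S _ /=; rewrite linearP mulrzDl scalerMzr.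
Qed.

HB.instance Definition _ K k :=
  GRing.isLinear.Build F (cochain K k) (cochain K k.+1) *:%R (@delta K k)
    (@delta_linear K k).

Let kcell_face K k (T : kcell K k.+1) (S : kcell K k) :
  subcell (val S) (val T) -> face1 (val S) (val T).
Proof. by move=> ST; rewrite /face1 ST !kcell_dim eqxx. Qed.

Let kcell_sum K k (T : kcell K k.+1) (f : cell X -> int) :
  (forall S, ~~ face1 S (val T) -> f S = 0) ->
  \sum_(S : kcell K k) f (val S) = \sum_S f S.
Proof.
move=> f0; rewrite [RHS](bigID (fun S => (S \in subcomplex_set K) && (dim S == k))) /=.
rewrite [X in _ + X]big1 ?addr0 => [|S nS]; last first.
  apply: f0; apply: contra nS => /andP[ST /eqP dS].
  rewrite (subcomplex_closed ST (kcell_in T)) /=.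
  by move: dS; rewrite kcell_dim => -[->].
rewrite (reindex_omap (val : kcell K k -> cell X) insub) => [|S PS]; last first.
  by rewrite insubT.
by apply: eq_bigl => S; rewrite valK eqxx (valP S).
Qed.

Let deltaK K k (u : cochain K k) : delta (delta u) = 0.
Proof.
apply: dprodP => T; rewrite dprod0E.
pose G (S : kcell K k.+1) (U : kcell K k) : L (val T) :=
  transport L (val T) (val S) (transport L (val S) (val U) (u U))
    *~ (o (val T) (val S) * o (val S) (val U)).
transitivity (\sum_(U : kcell K k) \sum_(S : kcell K k.+1) G S U).
  rewrite exchange_big /= /delta big_mkcond; apply: eq_bigr => S _.
  case: ifPn => [ST|nST]; last first.
    rewrite big1 // => U _; rewrite /G rel_or_nface ?mul0r //.
    by rewrite /face1 negb_and nST.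
  rewrite linear_sum mulrz_suml big_mkcond; apply: eq_bigr => U _.
  case: ifPn => [US|nUS]; first by rewrite raddfMz -mulrzA mulrC.
  by rewrite /G (@rel_or_nface _ _ _ (val S)) ?mulr0 // /face1 negb_and nUS.
apply: big1 => U _.
have [S0 /andP[S0T US0]|noS] :=
  pickP (fun S : kcell K k.+1 => face1 (val S) (val T) && face1 (val U) (val S)).
  pose y := transport L (val T) (val S0) (transport L (val S0) (val U) (u U)).
  transitivity (\sum_(S : kcell K k.+1) y *~ (o (val T) (val S) * o (val S) (val U))).
    apply: eq_bigr => S _; rewrite /G.
    have [ST|/rel_or_nface ->] := boolP (face1 (val S) (val T)); last by rewrite mul0r.
    have [US|/rel_or_nface ->] := boolP (face1 (val U) (val S)); last by rewrite mulr0.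
    by rewrite (transport_flat ST S0T US US0).
  rewrite -mulrz_sumr (kcell_sum (T := T) (f := fun S => o (val T) S * o S (val U))).
    by rewrite rel_or_codim2.
  by move=> S /rel_or_nface ->; rewrite mul0r.
apply: big1 => S _; rewrite /G.
have /negbT := noS S; rewrite negb_and => /orP[] /rel_or_nface ->.
  by rewrite mul0r.
by rewrite mulr0.
Qed.

Definition cochains K : cochain_complex F := CochainComplex (@deltaK K).

End Cochains.

(* Degrees are natural numbers: the spaces vanish in negative degrees, where
   the compatibility of [fe_ev] with the differential is trivial.  The map
   [fe_res k S T] goes from [T] to [S] and is meaningful only when [S] is a
   subcell of [T]. *)
Record fe_system (F : fieldType) (R : realType) (X : cellular_complex R)
    (o : orientation X) (L : flat_bundle F X) := FESystem {
  fe_space :> nat -> cell X -> lmodType F;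
  fe_diff : forall k T, {linear fe_space k T -> fe_space k.+1 T};
  fe_diffK : forall k T (u : fe_space k T), fe_diff k.+1 T (fe_diff k T u) = 0;
  fe_res : forall k S T, {linear fe_space k T -> fe_space k S};
  fe_res_diff : forall k S T, subcell S T -> forall u : fe_space k T,
    fe_res k.+1 S T (fe_diff k T u) = fe_diff k S (fe_res k S T u);
  fe_res_id : forall k T (u : fe_space k T), fe_res k T T u = u;
  fe_res_comp : forall k U S T, subcell U S -> subcell S T ->
    forall u : fe_space k T, fe_res k U T u = fe_res k U S (fe_res k S T u);
  fe_ev : forall k T, dim T = k -> {linear fe_space k T -> L T};
  fe_ev_diff : forall k T (dT : dim T = k.+1) (u : fe_space k T),
    fe_ev dT (fe_diff k T u) =
      \sum_(S : kcell (boundary_cx T) k)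
        transport L T (val S) (fe_ev (kcell_dim S) (fe_res k (val S) T u))
          *~ o T (val S) }.

Arguments fe_diff {F R X o L} _ {k T}.
Arguments fe_res {F R X o L} _ {k} S T.
Arguments fe_ev {F R X o L} _ {k T}.

Section FiniteElementSystem.
Variables (F : fieldType) (R : realType) (X : cellular_complex R).
Variables (o : orientation X) (L : flat_bundle F X) (A : fe_system o L).
Implicit Type K : subcomplex X.

Definition local_complex (T : cell X) : cochain_complex F :=
  @CochainComplex F (A^~ T) (fun k => fe_diff A) (fun k => @fe_diffK _ _ _ _ _ A k T).

Definition kcells K := {T : cell X | T \in subcomplex_set K}.

Definition families K k := dprod (fun T : kcells K => A k (val T)).

Definition compatible_family K k : {pred families K k} := fun u =>
  `[< forall S T : kcells K, subcell (val S) (val T) ->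
        u S = fe_res A (val S) (val T) (u T) >].

Let compatible_family_closed K k : submod_closed (@compatible_family K k).
Proof.
split=> [|a u v]; rewrite !unfold_in.
  by apply/asboolP => S T _; rewrite !dprod0E linear0.
move=> /asboolP uP /asboolP vP; apply/asboolP => S T ST.
by rewrite !dprodDE !dprodZE linearP -uP // -vP.
Qed.

HB.instance Definition _ K k :=
  GRing.isSubmodClosed.Build F (families K k) (@compatible_family K k)
    (@compatible_family_closed K k).

Definition glued K k := submodule (@compatible_family K k).

Lemma gluedP K k (u : glued K k) (S T : kcells K) :
  subcell (val S) (val T) -> val u S = fe_res A (val S) (val T) (val u T).
Proof. by case: u => u /= /asboolP; apply. Qed.

Let glued_diff_subproof K k (u : glued K k) :
  (fun T : kcells K => fe_diff A (val u T)) \in @compatible_family K k.+1.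
Proof.
by apply/asboolP => S T ST /=; rewrite (gluedP u ST) fe_res_diff.
Qed.

Definition glued_diff K k (u : glued K k) : glued K k.+1 :=
  Submodule (glued_diff_subproof u).

Let glued_diff_linear K k : linear (@glued_diff K k).
Proof.
move=> a u v; apply: val_inj; apply: dprodP => T /=.
by rewrite !(dprodDE, dprodZE) linearP.
Qed.

HB.instance Definition _ K k :=
  GRing.isLinear.Build F (glued K k) (glued K k.+1) *:%R (@glued_diff K k)
    (@glued_diff_linear K k).

Let glued_diffK K k (u : glued K k) : glued_diff (glued_diff u) = 0.
Proof. by apply: val_inj; apply: dprodP => T /=; rewrite fe_diffK. Qed.

Definition glued_complex K : cochain_complex F := CochainComplex (@glued_diffK K).

Let kcell_cells K k (T : kcell K k) : kcells K := Sub (val T) (kcell_in T).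

Definition derham_fun K k (u : glued K k) : cochain L K k :=
  fun T => fe_ev A (kcell_dim T) (val u (kcell_cells T)).

Let derham_linear K k : linear (@derham_fun K k).
Proof.
by move=> a u v; apply: dprodP => T; rewrite /derham_fun !(dprodDE, dprodZE) linearP.
Qed.

HB.instance Definition _ K k :=
  GRing.isLinear.Build F (glued K k) (cochain L K k) *:%R (@derham_fun K k)
    (@derham_linear K k).

Let boundary_kcell_in K k (T : kcell K k.+1) (S : kcell (boundary_cx (val T)) k) :
  (val S \in subcomplex_set K) && (dim (val S) == k).
Proof.
rewrite (subcomplex_closed _ (kcell_in T)) ?kcell_dim ?eqxx //.
by have := kcell_in S; rewrite finset.in_set => /andP[].
Qed.

Let derham_diff K k (u : glued K k) :
  derham_fun (glued_diff u) = delta o (derham_fun u).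
Proof.
apply: dprodP => T; rewrite /derham_fun /delta /= fe_ev_diff.
pose h (S : kcell (boundary_cx (val T)) k) : kcell K k :=
  Sub (val S) (boundary_kcell_in S).
rewrite [RHS](reindex_omap h (fun S => insub (val S))) => [|S ST]; last first.
  case: insubP => [S' _ valS'|]; first by congr Some; apply: val_inj.
  rewrite finset.in_set ST kcell_dim eqxx andbT /= negbK => /eqP eST.
  have eST' : val S = val T := eST.
  by have /eqP := kcell_dim S; rewrite eST' kcell_dim eqn_leq ltnn.
apply: eq_big => [S|S _].
  have := kcell_in S; rewrite finset.in_set => /andP[ST _].
  by rewrite [insub _]valK eqxx andbT; apply/esym.
have ST : subcell (val (kcell_cells (h S))) (val (kcell_cells T)).
  by have := kcell_in S; rewrite finset.in_set => /andP[].
rewrite (gluedP u ST) /=.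
by rewrite (eq_irrelevance (kcell_dim (h S)) (kcell_dim S)).
Qed.

Definition derham K : cochain_map (glued_complex K) (cochains o L K) :=
  @CochainMap F (glued_complex K) (cochains o L K) (fun k => @derham_fun K k)
    (@derham_diff K).

Section Restriction.
Variables (T : cell X) (K : subcomplex X).
Hypothesis KT : {subset subcomplex_set K <= subcomplex_set (closure_cx T)}.

Let restrict_subproof k (u : A k T) :
  (fun S : kcells K => fe_res A (val S) T u) \in @compatible_family K k.
Proof.
apply/asboolP => U S US /=; apply: fe_res_comp => //.
by have := KT (valP S); rewrite finset.in_set.
Qed.

Definition restrict k (u : A k T) : glued K k := Submodule (restrict_subproof u).

Let restrict_linear k : linear (@restrict k).
Proof.
by move=> a u v; apply: val_inj; apply: dprodP => S; rewrite /= linearP.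
Qed.

HB.instance Definition _ k :=
  GRing.isLinear.Build F (A k T) (glued K k) *:%R (@restrict k) (@restrict_linear k).

Let restrict_diff k (u : A k T) : restrict (fe_diff A u) = glued_diff (restrict u).
Proof.
apply: val_inj; apply: dprodP => S /=; apply: fe_res_diff.
by have := KT (valP S); rewrite finset.in_set.
Qed.

Definition restrict_map : cochain_map (local_complex T) (glued_complex K) :=
  @CochainMap F (local_complex T) (glued_complex K) (fun k => @restrict k)
    restrict_diff.

End Restriction.

Let boundary_sub (T : cell X) :
  {subset subcomplex_set (boundary_cx T) <= subcomplex_set (closure_cx T)}.
Proof. by move=> S; rewrite !finset.in_set => /andP[]. Qed.

Let closure_sub (T : cell X) :
  {subset subcomplex_set (closure_cx T) <= subcomplex_set (closure_cx T)}.
Proof. by []. Qed.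

Definition flabby := forall (T : cell X) k (v : glued (boundary_cx T) k),
  exists u : A k T, restrict (@boundary_sub T) u = v.

(* The de Rham map on a single cell, [A^k(T)] being identified with
   [A^k(S(T))] through the restrictions to the subcells of [T]. *)
Definition local_derham (T : cell X) :
    cochain_map (local_complex T) (cochains o L (closure_cx T)) :=
  cochain_comp (derham (closure_cx T)) (restrict_map (@closure_sub T)).

Definition locally_exact := forall T, quasi_isomorphism (local_derham T).

Definition compatible := flabby /\ locally_exact.

End FiniteElementSystem.

(* Main.v *)
(* A subcomplex K is built by attaching a maximal cell T to the subcomplex
   K \ {T}.  Restriction makes A(K) the fibre product of A(K \ {T}) and A(T)
   over A(bd T), where A(T) -> A(bd T) is onto by flabbiness; the cellular
   cochains have the same property.  Both squares combine into such a square of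
   mapping cones of de Rham maps, and a Mayer-Vietoris chase shows that the cone
   over K is acyclic if the cones over K \ {T}, T and bd T are: the cone over T
   by local exactness, the two others by induction on the number of cells. *)
From HB Require Import structures.
Require Import Defs.
From mathcomp Require Import all_boot all_order all_algebra reals.
From mathcomp Require Import boolp.

Set Implicit Arguments.
Unset Strict Implicit.
Unset Printing Implicit Defensive.

Import GRing.Theory.
Local Open Scope ring_scope.

(** * Acyclic complexes and mapping cones *)

Definition acyclic (F : fieldType) (C : cochain_complex F) :=
  forall k (x : C k), cdiff C x = 0 -> is_coboundary x.

Section Cone.
Variables (F : fieldType) (C D : cochain_complex F) (f : cochain_map C D).

(* In degree 0 the second factor, [D] in degree [-1], is zero and is omitted. *)
Definition cone_obj k : lmodType F :=
  match k with 0 => C 0 | j.+1 => (C j.+1 * D j)%type end.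

Definition cone_diff k : cone_obj k -> cone_obj k.+1 :=
  match k with
  | 0 => fun x => (cdiff C x, f 0 x)
  | j.+1 => fun x => (cdiff C x.1, f j.+1 x.1 - cdiff D x.2)
  end.

Lemma cone_diff_linear k : linear (@cone_diff k).
Proof.
case: k => [|k] a u v /=; apply/eqP; rewrite xpair_eqE /= !linearP eqxx //=.
by rewrite scalerDr addrACA.
Qed.

HB.instance Definition _ k :=
  GRing.isLinear.Build F (cone_obj k) (cone_obj k.+1) *:%R (@cone_diff k)
    (@cone_diff_linear k).

Lemma cone_diffK k (x : cone_obj k) : cone_diff (cone_diff x) = 0.
Proof.
case: k x => [|k] x /=.
  by rewrite cdiffK cmap_diff subrr.
by rewrite linearB /= !cdiffK subr0 cmap_diff subrr.
Qed.

Definition cone : cochain_complex F := CochainComplex cone_diffK.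

Lemma cohomology_map_eq0 k (z : cocycles C k) :
  cohomology_map f (qproj (coboundary (k := k)) z) = 0 ->
  is_coboundary (f k (val z)).
Proof.
rewrite cohomology_mapE -(linear0 (qproj (coboundary (k := k)))).
by move/qprojP; rewrite subr0 => /asboolP.
Qed.

(** Injectivity: if [f z = d y], the first entry of a primitive of the cone cocycle [(z, y)] is a
    primitive of [z]. Surjectivity: a cocycle [z] of [D] gives the cone cocycle [(0, z)], and a
    primitive [(x, w)] of it satisfies [f x - d w = z]. *)
Lemma acyclic_cone_quasi_isomorphism : acyclic cone -> quasi_isomorphism f.
Proof.
move=> ac; suff qf k : bijective (cohomology_map f (k := k)) by exact: qf.
have inj : injective (cohomology_map f (k := k)).
  apply: raddf_inj => h; rewrite -[h]qprojK; move: (generic_quotient.repr h) => z.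
  move=> /cohomology_map_eq0 fz.
  rewrite -(linear0 (qproj (coboundary (k := k)))); apply/qprojP; rewrite subr0.
  apply/asboolP; case: k h z fz => [|k] h [z /= /eqP dz].
    (* In degree 0 the only coboundary is 0, so [f z = 0] and [z] is itself a cone cocycle. *)
    by move=> fz; apply: (ac 0 z); rewrite /= dz fz.
  move=> [y dy]; have [|x] := ac k.+1 (z, y); first by rewrite /= dz dy subrr.
  by case: k z y {dz dy h} x => [|k] z y x [dx _]; [exists x | exists x.1].
have surj (h : cohomology D k) : exists h', cohomology_map f h' = h.
  rewrite -[h]qprojK; set z := generic_quotient.repr h.
  have dz : cdiff D (val z) = 0 by apply/eqP; exact: (valP z).
  have [|x] := ac k.+1 (0, val z); first by rewrite /= !linear0 dz subrr.
  case: k inj h z dz x => [|k] inj h z dz x [dx fx].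
    have xP : x \in cocycle (C := C) (k := 0) by apply/eqP.
    exists (qproj _ (Submodule xP)); rewrite cohomology_mapE; congr (qproj _ _).
    exact: val_inj.
  have xP : x.1 \in cocycle (C := C) (k := k.+1) by apply/eqP.
  exists (qproj _ (Submodule xP)); rewrite cohomology_mapE; apply/qprojP.
  by apply/asboolP; exists x.2; rewrite /= -fx opprB addrC subrK.
have [g gK] := choice surj.
by exists g => // h; apply: inj.
Qed.

(** For a cone cocycle [(x, y)], [f x = d y], so injectivity gives [x = d x1]. Then [y - f x1] is a
    cocycle, and surjectivity writes it as [f x2 - d w] with [x2] a cocycle. The primitive is
    [(x1 + x2, w)], without [w] when [y] has degree 0. *)
Lemma quasi_isomorphism_acyclic_cone : quasi_isomorphism f -> acyclic cone.
Proof.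
move=> qf0; have qf k : bijective (cohomology_map f (k := k)) := qf0 k.
have injP k (x : C k) : cdiff C x = 0 -> is_coboundary (f k x) -> is_coboundary x.
  move=> dx fx; have xP : x \in cocycle (C := C) (k := k) by apply/eqP.
  have /(bij_inj (qf k)) : cohomology_map f (qproj (coboundary (k := k)) (Submodule xP))
      = cohomology_map f (qproj (coboundary (k := k)) 0).
    rewrite !cohomology_mapE; apply/qprojP; rewrite linear0 subr0.
    exact/asboolP.
  by move/qprojP; rewrite subr0 => /asboolP.
have surjP k (y : D k) : cdiff D y = 0 ->
    exists2 x, cdiff C x = 0 & is_coboundary (f k x - y).
  move=> dy; have yP : y \in cocycle (C := D) (k := k) by apply/eqP.
  have [g _ gK] := qf k.
  have := gK (qproj _ (Submodule yP)); rewrite -[g _]qprojK.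
  move: (generic_quotient.repr _) => [x xP]; rewrite cohomology_mapE.
  by move/qprojP/asboolP => xy; exists x => //; apply/eqP.
case=> [|k] x /=; first by case=> dx fx; apply: (injP 0) => //.
case: x => x y [/= dx] /eqP; rewrite subr_eq0 => /eqP fx.
have [|x1 dx1] := injP k.+1 x dx; first by exists y.
have [|x2 dx2 fx2] := surjP k (y - f k x1).
  by rewrite linearB -cmap_diff dx1 fx subrr.
case: k x y dx fx x1 dx1 x2 dx2 fx2 => [|k] x y dx fx x1 dx1 x2 dx2 /=.
  move=> /eqP; rewrite subr_eq0 => /eqP fx2.
  by exists (x1 + x2); rewrite !linearD dx1 dx2 addr0 fx2 addrC subrK.
move=> [w dw]; exists (x1 + x2, w) => /=; congr pair.
  by rewrite linearD dx1 dx2 addr0.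
by rewrite dw linearD opprB addrC -(addrA y) -opprD subrK.
Qed.

End Cone.

(** * Functoriality of the mapping cone *)

Section ConeMap.
Variables (F : fieldType) (C D C' D' : cochain_complex F).
Variables (f : cochain_map C D) (f' : cochain_map C' D').
Variables (g : cochain_map C C') (h : cochain_map D D').
Hypothesis comm : forall k (x : C k), f' k (g k x) = h k (f k x).

Definition cone_map_fun k : cone f k -> cone f' k :=
  match k with 0 => g 0 | j.+1 => fun x => (g j.+1 x.1, h j x.2) end.

Lemma cone_map_linear k : linear (@cone_map_fun k).
Proof. by case: k => [|k] a u v /=; rewrite !linearP. Qed.

HB.instance Definition _ k :=
  GRing.isLinear.Build F (cone f k) (cone f' k) *:%R (@cone_map_fun k)
    (@cone_map_linear k).

Lemma cone_map_diff k (x : cone f k) :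
  cone_map_fun (cdiff (cone f) x) = cdiff (cone f') (cone_map_fun x).
Proof.
by case: k x => [|k] x; rewrite /= ?linearB -?cmap_diff -?comm /=.
Qed.

Definition cone_map : cochain_map (cone f) (cone f') :=
  @CochainMap F (cone f) (cone f') (fun k => @cone_map_fun k) cone_map_diff.

End ConeMap.

(** * Mayer-Vietoris for pullback squares *)

(** An elementwise form of [N] being the fibre product of [P] and [M] over [Q] with [e] onto; it
    makes [0 -> N -> P + M -> Q -> 0] exact in each degree, the last map being [c - e]. *)
Record onto_pullback (F : fieldType) (N P M Q : cochain_complex F)
    (a : cochain_map N P) (b : cochain_map N M)
    (c : cochain_map P Q) (e : cochain_map M Q) : Prop := OntoPullback {
  pullback_glue : forall k (p : P k) (m : M k), c k p = e k m ->
    exists n, a k n = p /\ b k n = m;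
  pullback_sep : forall k (n n' : N k), a k n = a k n' -> b k n = b k n' -> n = n';
  pullback_comm : forall k n, c k (a k n) = e k (b k n);
  pullback_onto : forall k (q : Q k), exists m, e k m = q }.

Lemma acyclic_pullback (F : fieldType) (N P M Q : cochain_complex F)
    (a : cochain_map N P) (b : cochain_map N M)
    (c : cochain_map P Q) (e : cochain_map M Q) :
  onto_pullback a b c e -> acyclic P -> acyclic M -> acyclic Q -> acyclic N.
Proof.
move=> [glue sep comm e_surj] aP aM aQ k n dn.
have da : cdiff P (a k n) = 0 by rewrite -cmap_diff dn linear0.
have db : cdiff M (b k n) = 0 by rewrite -cmap_diff dn linear0.
have := aM _ _ db; have := aP _ _ da.
case: k n dn da db => [|k] n dn da db /=.
  by move=> a0 b0; apply: sep; rewrite linear0.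
move=> [p dp] [m dm].
(* [p] and [m] need not agree over [Q], but their difference there is exact and
   lifts to a coboundary of [M], by which [m] is corrected. *)
have dq : cdiff Q (c k p - e k m) = 0.
  by rewrite linearB -!cmap_diff dp dm comm subrr.
have [m' em' dm'] : exists2 m', e k m' = c k p - e k m & cdiff M m' = 0.
  move: (aQ _ _ dq); case: k n dn da db p dp m dm dq => [|k] n dn da db p dp m dm dq /=.
    by move=> ->; exists 0; rewrite linear0.
  move=> [q dq']; have [m' em'] := e_surj _ q.
  by exists (cdiff M m'); rewrite ?cdiffK // cmap_diff em'.
have [n' [an' bn']] := glue k p (m + m') ltac:(by rewrite linearD em' addrC subrK).
exists n'; apply: sep; rewrite cmap_diff ?an' ?bn' //.
by rewrite linearD dm' addr0.
Qed.

(** The four compatibilities make a commutative cube, hence a square of cones. In each positive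
    degree a cone is a product, so gluing, separation and surjectivity are checked on each
    factor. *)
Lemma quasi_isomorphism_pullback (F : fieldType)
    (N P M Q N' P' M' Q' : cochain_complex F)
    (a : cochain_map N P) (b : cochain_map N M)
    (c : cochain_map P Q) (e : cochain_map M Q)
    (a' : cochain_map N' P') (b' : cochain_map N' M')
    (c' : cochain_map P' Q') (e' : cochain_map M' Q')
    (fN : cochain_map N N') (fP : cochain_map P P')
    (fM : cochain_map M M') (fQ : cochain_map Q Q') :
    onto_pullback a b c e -> onto_pullback a' b' c' e' ->
    (forall k x, fP k (a k x) = a' k (fN k x)) ->
    (forall k x, fM k (b k x) = b' k (fN k x)) ->
    (forall k x, fQ k (c k x) = c' k (fP k x)) ->
    (forall k x, fQ k (e k x) = e' k (fM k x)) ->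
  quasi_isomorphism fP -> quasi_isomorphism fM -> quasi_isomorphism fQ ->
  quasi_isomorphism fN.
Proof.
move=> pb pb' Na Nb Pc Me.
move=> /quasi_isomorphism_acyclic_cone qP /quasi_isomorphism_acyclic_cone qM.
move=> /quasi_isomorphism_acyclic_cone qQ; apply: acyclic_cone_quasi_isomorphism.
apply: (@acyclic_pullback _ _ _ _ _ (cone_map Na) (cone_map Nb)
  (cone_map Pc) (cone_map Me)) => //; split.
- case=> [|k] /=; first exact: (pullback_glue pb).
  move=> [p p'] [m m'] /= [/(pullback_glue pb) [n [an bn]]].
  move=> /(pullback_glue pb') [n' [an' bn']].
  by exists (n, n'); rewrite /= an bn an' bn'.
- case=> [|k] /=; first exact: (pullback_sep pb).
  move=> [n n'] [m m'] /= [anm anm'] [bnm bnm'].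
  by rewrite (pullback_sep pb anm bnm) (pullback_sep pb' anm' bnm').
- by case=> [|k] n /=; rewrite !(pullback_comm pb) ?(pullback_comm pb').
- case=> [|k] /= q; first exact: (pullback_onto pb).
  have [m em] := pullback_onto pb q.1; have [m' em'] := pullback_onto pb' q.2.
  by exists (m, m'); rewrite /= em em' -surjective_pairing.
Qed.

(** * Restriction of glued families and cochains to a subcomplex *)

(** Proof irrelevance frees the evaluation from the particular proofs of dimension and membership,
    so that evaluations in different subcomplexes can be compared. *)
Lemma derham_funE (F : fieldType) (R : realType) (X : cellular_complex R)
    (o : orientation X) (L : flat_bundle F X) (A : fe_system o L)
    (K : subcomplex X) k (u : glued A K k) (T : kcell K k)
    (dT : Defs.dim (val T) = k) (KT : val T \in subcomplex_set K) :
  derham_fun u T = fe_ev A dT (val u (Sub (val T) KT)).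
Proof.
rewrite (eq_irrelevance dT (kcell_dim T)).
by rewrite (bool_irrelevance KT (kcell_in T)).
Qed.

Section Restriction.
Variables (F : fieldType) (R : realType) (X : cellular_complex R).
Variables (o : orientation X) (L : flat_bundle F X) (A : fe_system o L).
Variables (K K' : subcomplex X).
Hypothesis KK' : {subset subcomplex_set K <= subcomplex_set K'}.

Definition kcells_incl (T : kcells K) : kcells K' := Sub (val T) (KK' (valP T)).

Lemma glued_restr_subproof k (u : glued A K' k) :
  (fun T : kcells K => val u (kcells_incl T)) \in compatible_family (A := A) (K := K) (k := k).
Proof.
apply/asboolP => S T ST.
exact: (gluedP u (S := kcells_incl S) (T := kcells_incl T)).
Qed.

Definition glued_restr k (u : glued A K' k) : glued A K k :=
  Submodule (glued_restr_subproof u).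

Lemma glued_restrE k (u : glued A K' k) S (KS : S \in subcomplex_set K)
    (K'S : S \in subcomplex_set K') :
  val (glued_restr u) (Sub S KS) = val u (Sub S K'S).
Proof. by congr (val u (Sub _ _)); apply: bool_irrelevance. Qed.

Lemma glued_restr_linear k : linear (@glued_restr k).
Proof. by move=> a u v; apply: val_inj; apply: dprodP => T. Qed.

HB.instance Definition _ k :=
  GRing.isLinear.Build F (glued A K' k) (glued A K k) *:%R (@glued_restr k)
    (@glued_restr_linear k).

Lemma glued_restr_diff k (u : glued A K' k) :
  glued_restr (glued_diff u) = glued_diff (glued_restr u).
Proof. by apply: val_inj; apply: dprodP. Qed.

Definition glued_restr_map : cochain_map (glued_complex A K') (glued_complex A K) :=
  @CochainMap F (glued_complex A K') (glued_complex A K) (fun k => @glued_restr k)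
    glued_restr_diff.

Lemma kcell_incl_subproof k (T : kcell K k) :
  (val T \in subcomplex_set K') && (Defs.dim (val T) == k).
Proof. by rewrite KK' ?kcell_in // kcell_dim eqxx. Qed.

Definition kcell_incl k (T : kcell K k) : kcell K' k :=
  Sub (val T) (kcell_incl_subproof T).

Definition cochain_restr k (u : cochain L K' k) : cochain L K k :=
  fun T => u (kcell_incl T).

Lemma cochain_restrE k (u : cochain L K' k) S
    (KS : (S \in subcomplex_set K) && (Defs.dim S == k))
    (K'S : (S \in subcomplex_set K') && (Defs.dim S == k)) :
  cochain_restr u (Sub S KS) = u (Sub S K'S).
Proof. by congr (u (Sub _ _)); apply: bool_irrelevance. Qed.

Lemma cochain_restr_linear k : linear (@cochain_restr k).
Proof. by move=> a u v; apply: dprodP => T. Qed.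

HB.instance Definition _ k :=
  GRing.isLinear.Build F (cochain L K' k) (cochain L K k) *:%R (@cochain_restr k)
    (@cochain_restr_linear k).

(** Since [K] is closed under subcells, both sums run over the same faces of a cell of [K]. *)
Lemma cochain_restr_delta k (u : cochain L K' k) :
  cochain_restr (delta o u) = delta o (cochain_restr u).
Proof.
apply: dprodP => T; rewrite /cochain_restr /delta /=.
rewrite (reindex_omap (@kcell_incl k) (fun S => insub (val S))) => [|S ST]; last first.
  case: insubP => [S' _ valS'|]; first by congr Some; apply: val_inj.
  by rewrite (subcomplex_closed ST (kcell_in T)) kcell_dim eqxx.
by apply: eq_bigl => S; rewrite /= [insub _]valK eqxx andbT.
Qed.

Definition cochain_restr_map : cochain_map (cochains o L K') (cochains o L K) :=
  @CochainMap F (cochains o L K') (cochains o L K) (fun k => @cochain_restr k)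
    cochain_restr_delta.

Lemma derham_restr k (u : glued A K' k) :
  derham A K k (glued_restr u) = cochain_restr (derham A K' k u).
Proof.
apply: dprodP => T.
rewrite /cochain_restr /= (derham_funE _ (kcell_dim T) (kcell_in T)).
exact/esym/(derham_funE u (T := kcell_incl T)).
Qed.

End Restriction.

(** * Attaching a maximal cell *)

Section CellAttachment.
Variables (F : fieldType) (R : realType) (X : cellular_complex R).
Variables (o : orientation X) (L : flat_bundle F X) (A : fe_system o L).
Variables (K : subcomplex X) (T : cell X).
Hypothesis KT : T \in subcomplex_set K.
Hypothesis T_maximal : forall S, S \in subcomplex_set K -> subcell T S -> S = T.

(** Maximality enters here: a cell of [K] having [T] as a subcell is [T] itself, so removing [T]
    leaves a subcomplex. *)
Lemma punctured_closed S U :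
  subcell S U -> U \in [set V in subcomplex_set K | V != T] ->
  S \in [set V in subcomplex_set K | V != T].
Proof.
rewrite !inE => SU /andP[KU neUT]; rewrite (subcomplex_closed SU KU).
by apply: contra_neq neUT => ST; apply: T_maximal => //; rewrite -ST.
Qed.

Definition punctured := Subcomplex punctured_closed.

Lemma punctured_sub : {subset subcomplex_set punctured <= subcomplex_set K}.
Proof. by move=> S; rewrite inE => /andP[]. Qed.

Lemma closure_subK : {subset subcomplex_set (closure_cx T) <= subcomplex_set K}.
Proof. by move=> S; rewrite inE => /subcomplex_closed; apply. Qed.

Lemma boundary_closure_sub :
  {subset subcomplex_set (boundary_cx T) <= subcomplex_set (closure_cx T)}.
Proof. by move=> S; rewrite !inE => /andP[]. Qed.

Lemma boundary_punctured_sub :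
  {subset subcomplex_set (boundary_cx T) <= subcomplex_set punctured}.
Proof.
move=> S; rewrite !inE => /andP[ST ->]; rewrite andbT.
exact: subcomplex_closed ST KT.
Qed.

Lemma notin_punctured S : S \in subcomplex_set K ->
  (S \in subcomplex_set punctured) = false -> S = T.
Proof. by move=> KS; rewrite inE KS => /negbFE/eqP. Qed.

Lemma in_boundary S : subcell S T ->
  S \in subcomplex_set punctured -> S \in subcomplex_set (boundary_cx T).
Proof. by rewrite !inE => -> /andP[]. Qed.

Definition glued_eval k (u : glued A K k) : A k T := val u (Sub T KT).

Lemma glued_eval_linear k : linear (@glued_eval k).
Proof. by []. Qed.

HB.instance Definition _ k :=
  GRing.isLinear.Build F (glued A K k) (A k T) *:%R (@glued_eval k)
    (@glued_eval_linear k).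

Lemma glued_eval_diff k (u : glued A K k) :
  glued_eval (glued_diff u) = fe_diff A (glued_eval u).
Proof. by []. Qed.

Definition glued_eval_map : cochain_map (glued_complex A K) (local_complex A T) :=
  @CochainMap F (glued_complex A K) (local_complex A T) (fun k => @glued_eval k)
    glued_eval_diff.

(** The value at [T] determines those on its subcells, so [A(T)] itself can be the corner over the
    closure of [T]; flabbiness is then the surjectivity of the map to the boundary. *)
Lemma glued_onto_pullback : flabby A ->
  onto_pullback (glued_restr_map A punctured_sub) glued_eval_map
    (glued_restr_map A boundary_punctured_sub)
    (restrict_map A boundary_closure_sub).
Proof.
move=> fl; split=> [k p m pm|k n n' nn' nTn'|k n|k q].
- have pmE S (pS : S \in subcomplex_set punctured) : subcell S T ->
      val p (Sub S pS) = fe_res A S T m.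
    move=> ST; have bS := in_boundary ST pS.
    have := congr1 (fun v : glued A (boundary_cx T) k => val v (Sub S bS)) pm.
    rewrite /= /kcells_incl /= => <-.
    by rewrite (bool_irrelevance (boundary_punctured_sub _) pS).
  (* Only [T] reaches the second branch; restricting [m] gives a value of the right type there
     without a cast along [val S = T]. *)
  pose n : families A K k := fun S =>
    if @idP (val S \in subcomplex_set punctured) is ReflectT pS
    then val p (Sub (val S) pS) else fe_res A (val S) T m.
  have nin S (pS : val S \in subcomplex_set punctured) :
      n S = val p (Sub (val S) pS).
    by rewrite /n; case: {-}_ / idP => // pS'; rewrite (bool_irrelevance pS' pS).
  (* Both branches agree on subcells of [T], which settles compatibility between [T] and its
     boundary. *)
  have nout S : subcell (val S) T -> n S = fe_res A (val S) T m.
    by move=> ST; rewrite /n; case: {-}_ / idP => // pS'; apply: pmE.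
  have nP : n \in compatible_family (A := A) (K := K) (k := k).
    apply/asboolP => U S US.
    have [pS|/negbTE pS] := boolP (val S \in subcomplex_set punctured).
      have pU := subcomplex_closed US pS.
      rewrite (nin _ pS) (nin _ pU).
      exact: (gluedP p (S := Sub (val U) pU) (T := Sub (val S) pS)).
    have ST : subcell (val S) T.
      by rewrite (notin_punctured (valP S) pS) subcell_refl.
    by rewrite (nout _ ST) (nout _ (subcell_trans US ST)) (fe_res_comp US ST).
  exists (Submodule nP); split.
    apply: val_inj; apply: dprodP => -[S pS].
    exact: (nin (kcells_incl punctured_sub (Sub S pS)) pS).
  have := nout (Sub T KT) (subcell_refl T); rewrite fe_res_id; exact.
- apply: val_inj; apply: dprodP => S.
  have ST0 : val S \in subcomplex_set punctured \/ val S = T.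
    have [pS|/negbTE pS] := boolP (val S \in subcomplex_set punctured); first by left.
    by right; exact: (notin_punctured (valP S) pS).
  case: ST0 => [pS|ST].
    case: S pS => S KS pS; rewrite -!(glued_restrE punctured_sub _ pS KS).
    exact: (congr1 (fun v : glued A punctured k => val v (Sub S pS)) nn').
  case: S ST => S KS /= ST; subst S.
  by rewrite (bool_irrelevance KS KT).
- apply: val_inj; apply: dprodP => S /=.
  have KS : val S \in subcomplex_set K by exact/punctured_sub/boundary_punctured_sub/valP.
  have ST : subcell (val S) T by have := valP S; rewrite inE => /andP[].
  rewrite /kcells_incl /= (bool_irrelevance (punctured_sub _) KS).
  exact: (gluedP n (S := Sub (val S) KS) (T := Sub T KT)).
- have [u <-] := fl T k q; exists u.
  by apply: val_inj; apply: dprodP.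
Qed.

(** Cochains are arbitrary functions on cells, and the cells of [K] are the union of those of
    [punctured] and of the closure of [T], which meet in the boundary. *)
Lemma cochain_onto_pullback :
  onto_pullback (cochain_restr_map o L punctured_sub)
    (cochain_restr_map o L closure_subK)
    (cochain_restr_map o L boundary_punctured_sub)
    (cochain_restr_map o L boundary_closure_sub).
Proof.
split=> [k p m pm|k n n' nn' nTn'|k n|k q].
- have pmE S (pS : (S \in subcomplex_set punctured) && (Defs.dim S == k))
      (cS : (S \in subcomplex_set (closure_cx T)) && (Defs.dim S == k)) :
      p (Sub S pS) = m (Sub S cS).
    have bS : (S \in subcomplex_set (boundary_cx T)) && (Defs.dim S == k).
      case/andP: pS cS => pS -> /andP[cS _]; rewrite andbT in_boundary //.
      by move: cS; rewrite inE.
    rewrite -(cochain_restrE boundary_punctured_sub p bS).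
    rewrite -(cochain_restrE boundary_closure_sub m bS).
    exact: (congr1 (fun v : cochain L (boundary_cx T) k => v (Sub S bS)) pm).
  have pP (S : kcell K k) (pS : val S \in subcomplex_set punctured) :
      (val S \in subcomplex_set punctured) && (Defs.dim (val S) == k).
    by rewrite pS kcell_dim eqxx.
  have mP (S : kcell K k) (pS : ~ (val S \in subcomplex_set punctured)) :
      (val S \in subcomplex_set (closure_cx T)) && (Defs.dim (val S) == k).
    move/negP/negbTE: pS => /(notin_punctured (kcell_in S)) ST.
    by rewrite kcell_dim inE ST subcell_refl eqxx.
  pose n : cochain L K k := fun S =>
    match @idP (val S \in subcomplex_set punctured) with
    | ReflectT pS => p (Sub (val S) (pP S pS))
    | ReflectF pS => m (Sub (val S) (mP S pS))
    end.
  have nin (S : kcell K k)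
      (pS : (val S \in subcomplex_set punctured) && (Defs.dim (val S) == k)) :
      n S = p (Sub (val S) pS).
    rewrite /n; case: {-}_ / idP => [pS'|[]]; last by case/andP: pS.
    by rewrite (bool_irrelevance (pP _ _) pS).
  have nout (S : kcell K k)
      (cS : (val S \in subcomplex_set (closure_cx T)) && (Defs.dim (val S) == k)) :
      n S = m (Sub (val S) cS).
    rewrite /n; case: {-}_ / idP => [pS'|nS]; first exact: pmE.
    by rewrite (bool_irrelevance (mP _ _) cS).
  exists n; split; apply: dprodP => -[S KS].
    exact: (nin (kcell_incl punctured_sub (Sub S KS)) KS).
  exact: (nout (kcell_incl closure_subK (Sub S KS)) KS).
- apply: dprodP => S.
  have [pS|/negbTE pS] := boolP (val S \in subcomplex_set punctured).
    have PS : (val S \in subcomplex_set punctured) && (Defs.dim (val S) == k).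
      by rewrite pS kcell_dim eqxx.
    case: S pS PS => S KS pS PS.
    rewrite -!(cochain_restrE punctured_sub _ PS KS).
    exact: (congr1 (fun v : cochain L punctured k => v (Sub S PS)) nn').
  have PS : (val S \in subcomplex_set (closure_cx T)) && (Defs.dim (val S) == k).
    by rewrite kcell_dim inE (notin_punctured (kcell_in S) pS) subcell_refl eqxx.
  case: S pS PS => S KS pS PS.
  rewrite -!(cochain_restrE closure_subK _ PS KS).
  exact: (congr1 (fun v : cochain L (closure_cx T) k => v (Sub S PS)) nTn').
- apply: dprodP => S; rewrite /= /cochain_restr /kcell_incl /=.
  by congr (n (Sub _ _)); apply: bool_irrelevance.
(* Extension by zero: the only cell outside the boundary is [T], when its dimension is [k]. *)
- pose m : cochain L (closure_cx T) k := fun S =>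
    if @idP ((val S \in subcomplex_set (boundary_cx T)) && (Defs.dim (val S) == k))
      is ReflectT bS then q (Sub (val S) bS) else 0.
  exists m; apply: dprodP => -[S bS]; rewrite /= /cochain_restr /m.
  by case: {-}_ / idP => // bS'; rewrite (bool_irrelevance bS' bS).
Qed.

Lemma derham_attach_cell : flabby A -> locally_exact A ->
    quasi_isomorphism (derham A punctured) ->
    quasi_isomorphism (derham A (boundary_cx T)) ->
  quasi_isomorphism (derham A K).
Proof.
move=> fl le qP qQ.
apply: (quasi_isomorphism_pullback (glued_onto_pullback fl) cochain_onto_pullback
  (fP := derham A punctured) (fM := local_derham A T)
  (fQ := derham A (boundary_cx T))) => //.
- by move=> k u; apply: derham_restr.
(* [local_derham] evaluates restrictions of the value at [T]; for a compatible family these are its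
   own values on the subcells. *)
- move=> k u; apply: dprodP => S.
  have ST : subcell (val S) T by have := kcell_in S; rewrite inE.
  rewrite /= /cochain_restr.
  rewrite (derham_funE _ (kcell_dim S) (kcell_in S)).
  rewrite (derham_funE u (T := kcell_incl closure_subK S) (kcell_dim S)
             (closure_subK (kcell_in S))) /=.
  by rewrite (gluedP u (S := Sub (val S) (closure_subK (kcell_in S))) (T := Sub T KT)).
- by move=> k u; apply: derham_restr.
- move=> k u; apply: dprodP => S.
  rewrite /= /cochain_restr.
  rewrite (derham_funE _ (kcell_dim S) (kcell_in S)).
  by rewrite (derham_funE _ (T := kcell_incl boundary_closure_sub S) (kcell_dim S)
             (boundary_closure_sub (kcell_in S))).
Qed.

End CellAttachment.

(** * Induction on the number of cells *)

(** An arbitrary subcomplex is allowed so that the induction hypothesis covers both [punctured] and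
    the boundary of [T]. *)
Lemma derham_quasi_isomorphism (F : fieldType) (R : realType) (X : cellular_complex R)
    (o : orientation X) (L : flat_bundle F X) (A : fe_system o L) (K : subcomplex X) :
  compatible A -> quasi_isomorphism (derham A K).
Proof.
move=> [fl le]; have [n] := ubnP #|subcomplex_set K|; elim: n K => // n IHn K ltKn.
have [K0|[T0 KT0]] := set_0Vmem (subcomplex_set K).
  have noK T : T \in subcomplex_set K -> False by rewrite K0 inE.
  have glued0 k (u v : glued A K k) : u = v.
    by apply: val_inj; apply: dprodP => S; case: (noK _ (valP S)).
  have cochain0 k (u v : cochain L K k) : u = v.
    by apply: dprodP => S; case: (noK _ (kcell_in S)).
  (* Over the empty subcomplex the cone is zero. Degrees 0 and 1 are apart because the cone has no
     second factor in degree 0. *)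
  apply: acyclic_cone_quasi_isomorphism => -[|[|k]]; first by move=> x _; exact: glued0.
    by move=> [x y] _; exists 0; congr pair; [exact: glued0 | exact: cochain0].
  by move=> [x y] _; exists 0; congr pair; [exact: glued0 | exact: cochain0].
(* Maximizing the number of subcells yields a maximal cell without comparing
   dimensions, which would require invariance of domain. *)
pose T := [arg max_(T > T0 in subcomplex_set K) #|subcomplex_set (closure_cx T)|].
have [KT Tmax] : T \in subcomplex_set K /\
    forall S, S \in subcomplex_set K -> subcell T S -> S = T.
  rewrite /T; case: arg_maxnP => // {}T KT Tmax; split=> // S KS TS.
  apply: (subcell_anti _ TS).
  have sTS : subcomplex_set (closure_cx T) \subset subcomplex_set (closure_cx S).
    by apply/subsetP => U; rewrite !inE => /subcell_trans; apply.
  have /eqP eTS : subcomplex_set (closure_cx T) == subcomplex_set (closure_cx S).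
    by rewrite eqEcard sTS; apply: Tmax.
  have : S \in subcomplex_set (closure_cx T) by rewrite eTS inE subcell_refl.
  by rewrite inE.
have pK : subcomplex_set (punctured Tmax) \proper subcomplex_set K.
  apply/properP; split; first exact/subsetP/punctured_sub.
  by exists T => //; rewrite inE eqxx andbF.
have ltPn : (#|subcomplex_set (punctured Tmax)| < n)%N.
  exact: leq_trans (proper_card pK) ltKn.
apply: (derham_attach_cell KT (T_maximal := Tmax)) => //; apply: IHn => //.
(* The boundary of [T] lies in [punctured], so it too has fewer cells than [K]. *)
apply: leq_ltn_trans ltPn; apply/subset_leq_card/subsetP.
exact: boundary_punctured_sub.
Qed.

Theorem theorem3p2 (R : realType) (F : fieldType) (X : cellular_complex R)
  (o : orientation X) (L : flat_bundle F X) (A : fe_system o L) :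
  compatible A -> quasi_isomorphism (derham A (whole X)).
Proof. exact: derham_quasi_isomorphism. Qed.
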